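(* Let $(G,X,x_0)$ be a $0$-dimensional ambit. If the $G$-ambit $X$ is WAP, then it has sep. fin. EDRdeg.
   Context: Compact spaces are Hausdorff. A flow $(G,X)$ is a topological group $G$ acting continuously on a compact space $X$. An ambit $(G,X,x_0)$ is a flow with a distinguished point $x_0\in X$ whose orbit is dense; it is $0$-dimensional if $X$ has a basis of clopen sets. $\mathcal{B}$ denotes the algebra of clopen subsets of $X$. The flow $(G,X)$ is WAP (weakly almost periodic) if for every $f\in C(X)$ the set of translates of $f$ by elements of $G$ is relatively compact in the weak topology of the Banach space $C(X)$ (equivalently, every element of the Ellis semigroup of $X$ is a continuous map $X\to X$). A coloring is a function $c\colon G\to 2^n$, $n\ge 1$. For $\Sigma\subseteq\mathcal{B}$, $c$ is an externally definable $\Sigma$-coloring if there are $U_0,\dots,U_{n-1}\in\Sigma$ and $y_0,\dots,y_{n-1}\in X$ such that for all $g\in G$, $i<n$: $c(g)(i)=1$ if $y_i\in gU_i$ and $c(g)(i)=0$ if $y_i\notin gU_i$. The ambit has separately finite externally definable Ramsey degree (sep. fin. EDRdeg) if for every finite $\Sigma\subseteq\mathcal{B}$ there is $l\ge 1$ such that for every externally definable $\Sigma$-coloring $c\colon G\to 2^n$ (any $n\geq 1$), every $k\ge 1$ and every $k$-element $A\subseteq G$, there is $h\in G$ with $|c[hA]|\le l$. *)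

(* Defs.v *)
From HB Require Import structures.
From mathcomp Require Import all_boot all_order all_algebra.
From mathcomp Require Import finmap.
From mathcomp Require Import all_classical all_reals.
From mathcomp Require Import topology normedtype.

Set Implicit Arguments.
Unset Strict Implicit.
Unset Printing Implicit Defensive.

Import Order.TTheory GRing.Theory Num.Theory.
Import numFieldNormedType.Exports.

Local Open Scope classical_set_scope.
Local Open Scope ring_scope.

(* No separation axiom is imposed on the group. *)
HB.mixin Record PreTopologicalGroup_isTopologicalGroup G
    & Topological G & Group G := {
  mulg_continuous : continuous (fun p : G * G => (p.1 * p.2)%g) ;
  invg_continuous : continuous (fun g : G => (g^-1)%g)
}.

#[short(type="topologicalGroupType")]
HB.structure Definition TopologicalGroup :=
  {G of Topological G & Group G
   & PreTopologicalGroup_isTopologicalGroup G}.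

HB.mixin Record Topological_isCompactHausdorff X & Topological X := {
  compactT : compact [set: X] ;
  hausdorffT : hausdorff_space X
}.

#[short(type="compactHausdorffType")]
HB.structure Definition CompactHausdorff :=
  {X of Topological X & Topological_isCompactHausdorff X}.

Section ContFun.
Context (R : realType) (X : compactHausdorffType).

(* C(X): real-valued continuous functions with the sup norm.  The alias keeps
   this norm apart from the other topologies on [continuousType].  Completeness
   is not recorded, as the weak topology does not depend on it. *)
Definition contfun : Type := continuousType X R.

HB.instance Definition _ := Choice.on contfun.

Implicit Types f g h : contfun.

Definition ev f : X -> R := (f : continuousType X R).

Lemma contfunP f g : ev f =1 ev g -> f = g.
Proof. by move=> fg; apply/continuousEP. Qed.

Lemma ev_continuous f : continuous (ev f).
Proof. exact: cts_fun. Qed.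

Lemma contfun_zero_subproof : continuous (fun _ : X => 0 : R).
Proof. by move=> x; exact: cvg_cst. Qed.

Lemma contfun_opp_subproof f : continuous (fun x => - ev f x).
Proof. by move=> x; apply: cvgN; exact: ev_continuous. Qed.

Lemma contfun_add_subproof f g : continuous (fun x => ev f x + ev g x).
Proof. by move=> x; apply: cvgD; exact: ev_continuous. Qed.

Lemma contfun_scale_subproof (a : R) f : continuous (fun x => a * ev f x).
Proof. by move=> x; apply: cvgM; [exact: cvg_cst|exact: ev_continuous]. Qed.

Definition contfun_zero : contfun := mkcts contfun_zero_subproof.
Definition contfun_opp f : contfun := mkcts (@contfun_opp_subproof f).
Definition contfun_add f g : contfun := mkcts (@contfun_add_subproof f g).
Definition contfun_scale a f : contfun := mkcts (@contfun_scale_subproof a f).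

Lemma contfun_addA : associative contfun_add.
Proof. by move=> f g h; apply/contfunP => x; exact: addrA. Qed.
Lemma contfun_addC : commutative contfun_add.
Proof. by move=> f g; apply/contfunP => x; exact: addrC. Qed.
Lemma contfun_add0 : left_id contfun_zero contfun_add.
Proof. by move=> f; apply/contfunP => x; exact: add0r. Qed.
Lemma contfun_addN : left_inverse contfun_zero contfun_opp contfun_add.
Proof. by move=> f; apply/contfunP => x; exact: addNr. Qed.

HB.instance Definition _ := GRing.isZmodule.Build contfun
  contfun_addA contfun_addC contfun_add0 contfun_addN.

Lemma contfun_scaleA a b f :
  contfun_scale a (contfun_scale b f) = contfun_scale (a * b) f.
Proof. by apply/contfunP => x; exact: mulrA. Qed.
Lemma contfun_scale1 : left_id 1 contfun_scale.
Proof. by move=> f; apply/contfunP => x; exact: mul1r. Qed.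
Lemma contfun_scaleDr : right_distributive contfun_scale +%R.
Proof. by move=> a f g; apply/contfunP => x; exact: mulrDr. Qed.
Lemma contfun_scaleDl f :
  {morph contfun_scale^~ f : a b / a + b >-> a + b}.
Proof. by move=> a b; apply/contfunP => x; exact: mulrDl. Qed.

HB.instance Definition _ := GRing.Zmodule_isLmodule.Build R contfun
  contfun_scaleA contfun_scale1 contfun_scaleDr contfun_scaleDl.

Definition sup_norm f : R := sup (range (fun x => `|ev f x|)).

Lemma contfun_bounded f : has_ubound (range (fun x => `|ev f x|)).
Proof.
have : compact (range (ev f)).
  apply: continuous_compact; last exact: compactT.
  exact/continuous_subspaceT/ev_continuous.
move=> /compact_bounded [M [_ /(_ (M + 1))]] /(_ _)/wrap[|].
  by rewrite ltrDl.
by move=> H; exists (M + 1) => _ [x _ <-]; apply: H; exists x.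
Qed.

Lemma le_sup_norm f x : `|ev f x| <= sup_norm f.
Proof. by apply: ub_le_sup; [exact: contfun_bounded|exists x]. Qed.

Lemma sup_norm_empty f : ~ ([set: X] !=set0) -> sup_norm f = 0.
Proof.
move=> X0; suff -> : sup_norm f = sup set0 by rewrite sup0.
congr sup; apply/seteqP; split; last exact: sub0set.
by move=> y [x _ _]; case: X0; exists x.
Qed.

Lemma sup_norm_ge0 f : 0 <= sup_norm f.
Proof.
have [[x _]|X0] := pselect ([set: X] !=set0).
  exact: le_trans (le_sup_norm f x).
by rewrite sup_norm_empty.
Qed.

Lemma sup_norm_le f (M : R) :
  0 <= M -> (forall x, `|ev f x| <= M) -> sup_norm f <= M.
Proof.
move=> M0 fM.
have [[x0 _]|X0] := pselect ([set: X] !=set0).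
  by apply: ge_sup; [exists `|ev f x0|, x0|move=> _ [x _ <-]].
by rewrite sup_norm_empty.
Qed.

Lemma sup_normD f g : sup_norm (f + g) <= sup_norm f + sup_norm g.
Proof.
apply: sup_norm_le => [|x]; first by rewrite addr_ge0 ?sup_norm_ge0.
exact: le_trans (ler_normD _ _) (lerD (le_sup_norm f x) (le_sup_norm g x)).
Qed.

Lemma sup_normZ (a : R) f : sup_norm (a *: f) = `|a| * sup_norm f.
Proof.
have le b h : sup_norm (b *: h) <= `|b| * sup_norm h.
  apply: sup_norm_le => [|x]; first by rewrite mulr_ge0 ?sup_norm_ge0.
  by rewrite [ev _ _](_ : _ = b * ev h x)// normrM ler_wpM2l// le_sup_norm.
apply/eqP; rewrite eq_le le /=.
have [->|a0] := eqVneq a 0; first by rewrite normr0 mul0r sup_norm_ge0.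
have := le a^-1 (a *: f); rewrite scalerA mulVf// scale1r normfV.
by rewrite mulrC ler_pdivlMr ?normr_gt0// mulrC.
Qed.

Lemma sup_norm_eq0 f : sup_norm f = 0 -> f = 0.
Proof.
move=> f0; apply/contfunP => x; apply/eqP.
by rewrite -[ev 0 x]/0 -normr_le0 -f0 le_sup_norm.
Qed.

HB.instance Definition _ := Lmodule_isNormed.Build R contfun
  sup_normD sup_normZ sup_norm_eq0.

End ContFun.

(* The weak topology of [V]: the initial topology for the evaluation map of
   [V] into the product of copies of the scalars indexed by the continuous
   dual of [V]. *)
Definition continuous_dual (R : realType) (V : normedModType R) : Type :=
  {phi : {linear V -> R^o} | continuous phi}.

HB.instance Definition _ (R : realType) (V : normedModType R) :=
  gen_eqMixin (continuous_dual V).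
HB.instance Definition _ (R : realType) (V : normedModType R) :=
  gen_choiceMixin (continuous_dual V).

Definition dual_pairing (R : realType) (V : normedModType R) (v : V) :
    {ptws continuous_dual V -> R^o} :=
  fun phi => sval phi v.

Definition weak (R : realType) (V : normedModType R) : Type :=
  initial_topology (@dual_pairing R V).

HB.instance Definition _ (R : realType) (V : normedModType R) :=
  Topological.on (weak V).

Record flow (G : topologicalGroupType) (X : compactHausdorffType) := Flow {
  act :> G -> X -> X ;
  act1 : forall x, act 1%g x = x ;
  actM : forall g h x, act (g * h)%g x = act g (act h x) ;
  act_continuous : continuous (fun p : G * X => act p.1 p.2)
}.

Section Flows.
Context (G : topologicalGroupType) (X : compactHausdorffType) (a : flow G X).

Definition is_ambit (x0 : X) : Prop := dense [set a g x0 | g in [set: G]].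

(* The library's [zero_dimensional] only asks for clopen sets separating points;
   without compactness that is a weaker property. *)
Definition clopen_basis : Prop := basis [set U : set X | clopen U].

Lemma act_continuousr (g : G) : continuous (a g).
Proof.
move=> x; apply: (@continuous_comp _ _ _ (fun y => (g, y))
  (fun p : G * X => a p.1 p.2)); last exact: act_continuous.
by apply: cvg_pair; [exact: cvg_cst|exact: cvg_id].
Qed.

Lemma translate_subproof (R : realType) (g : G) (f : contfun R X) :
  continuous (fun x => ev f (a g^-1%g x)).
Proof.
move=> x; apply: (@continuous_comp _ _ _ (a g^-1%g) (ev f)).
  exact: act_continuousr.
exact: ev_continuous.
Qed.

Definition translate (R : realType) (g : G) (f : contfun R X) : contfun R X :=
  mkcts (@translate_subproof R g f).

Definition WAP (R : realType) : Prop := forall f : contfun R X,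
  precompact ([set translate g f | g in [set: G]] : set (weak (contfun R X))).

(* [2 ^ n] is [{ffun 'I_n -> bool}], and [act g @` U i] is the translate
   [g U_i]. *)
Definition ext_def_coloring (Sigma : set (set X)) (n : nat)
    (c : G -> {ffun 'I_n -> bool}) : Prop :=
  exists (U : 'I_n -> set X) (y : 'I_n -> X),
    (forall i, Sigma (U i)) /\
    (forall g i, c g i = true <-> (a g @` U i) (y i)).

Definition sep_fin_EDRdeg : Prop :=
  forall Sigma : set (set X), finite_set Sigma -> Sigma `<=` clopen ->
  exists2 l : nat, (1 <= l)%N &
  forall (n : nat) (c : G -> {ffun 'I_n -> bool}),
    (1 <= n)%N -> ext_def_coloring Sigma c ->
  forall (k : nat) (A : {fset G}), (1 <= k)%N -> #|` A|%fset = k ->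
  exists h : G, (#|` [fset c (h * x)%g | x in A]%fset| <= l)%N.

End Flows.

(* Main.v *)
From HB Require Import structures.
Require Import Defs.
From mathcomp Require Import all_boot all_order all_algebra.
From mathcomp Require Import finmap.
From mathcomp Require Import all_classical all_reals.
From mathcomp Require Import topology normedtype.

(** Everything is read off the return functions [t_y : g |-> (g y \in U)] of
    points [y] under a clopen set [U], as elements of the Cantor space [2^G] on
    which [G] acts by right translation.  A coloring built from sets [U_i] and
    points [y_i] is [c(h x)(i) = t_(y_i)(x^-1 h^-1)], so along a suitable choice
    of [h] it becomes, on any finite set, [x |-> (z_i(x^-1))_i], where
    [(z_i)_i] is a prescribed point of the orbit closure of [(t_(y_i))_i].
    It is enough to find such a [z] whose coordinates all lie in a finite set of
    functions [E] depending only on the family of clopen sets: the number of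
    colors is then at most [2^|E|], whatever the number of coordinates.

    Weak almost periodicity enters through Grothendieck's double limit
    criterion: the relation [g h x0 \in U] between [g] and [h] is stable, that
    is, limits along two ultrafilters commute ([WAP_stable]).  Since the orbit
    of [x0] is dense, every [t_y] is a pointwise limit of rows of that relation
    ([visits_row_closure]), and the rest is about stable relations on a group.

    - Any nonempty set of limits of rows of a stable relation has an isolated
      point ([stable_isolated]).  This is the fragmentability of weakly compact
      sets, for functions with values 0 and 1; it says that weakly compact sets
      of characteristic functions are scattered.
    - In a minimal subset of the orbit closure of [(t_(y_i))_i], the points
      whose [i]-th coordinate is a given isolated one form a relatively open
      set, and finitely many translates of it cover the minimal set.  Thus all
      coordinates have finite orbits ([exists_finite_translates]).
    - Only finitely many limits [t] of rows of [r(g h)] have a finite orbit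
      ([finite_translates_finite]).  Applied to [r(g^-1)], the previous point
      gives a function [w] with finitely many left translates which is a limit
      of left translates of [r].  Exchanging the limits defining [w] and [t]
      shows that [t] is a two-sided translate of [w]; two such functions [t]
      are right translates of each other.

    The set [E] consists of the limits with finite orbit for all the clopen sets
    in the family. *)

Set Implicit Arguments.
Unset Strict Implicit.
Unset Printing Implicit Defensive.

Local Open Scope classical_set_scope.

(** * Ultrafilters and stable relations *)

(** By Grothendieck's criterion this says that the rows of [R] form a relatively
    weakly compact set of bounded functions on [A].  The double limit property
    has the advantage of being symmetric in rows and columns. *)
Definition stable (A B : Type) (R : A -> B -> bool) : Prop :=
  forall (p : set_system A) (q : set_system B),
    UltraFilter p -> UltraFilter q ->
    (\forall a \near p, \forall b \near q, R a b) <->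
    (\forall b \near q, \forall a \near p, R a b).

(** The closure, in the product topology of [2^A], of the set of rows
    [R^~ b]; stating it with finite conditions avoids ultrafilters where only
    approximation is used. *)
Definition row_closure (A : eqType) (B : Type) (R : A -> B -> bool) :
    set (A -> bool) :=
  [set t | forall s : seq A, exists b, {in s, R^~ b =1 t}].

Lemma ultra_fmap (T U : Type) (f : T -> U) (p : set_system T) :
  UltraFilter p -> UltraFilter (f @ p).
Proof.
move=> up; split=> [|F PF sF]; first exact: fmap_proper_filter.
apply/seteqP; split => // V FV; rewrite /fmap /=.
have [//|pV] := in_ultra_setVsetC (f @^-1` V) up.
have : F (~` V) by apply: sF.
by move=> /(filterI FV); rewrite setICr => /filter_not_empty.
Qed.

Lemma ultra_nearN (T : Type) (p : set_system T) (P : T -> bool) :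
  UltraFilter p -> (\forall x \near p, ~~ P x) <-> ~ (\forall x \near p, P x).
Proof.
move=> up; split=> [nP /(filterI nP)|nP].
  by move=> /filter_ex[x [/negP]].
have [//|] := in_ultra_setVsetC [set x | P x] up.
by apply: filterS => x /= /negP.
Qed.

Lemma row_closureP (A : eqType) (B : Type) (R : A -> B -> bool) t :
  row_closure R t -> exists q : set_system B,
    UltraFilter q /\ forall a, \forall b \near q, R a b = t a.
Proof.
move=> Rt.
pose D (s : seq A) : set B := [set b | {in s, R^~ b =1 t}].
have PF : ProperFilter (filter_from [set: seq A] D).
  apply: filter_from_proper; last by move=> s _; exact: Rt.
  apply: filter_from_filter; first by exists [::].
  move=> s1 s2 _ _; exists (s1 ++ s2) => // b Db.
  by split=> a as_; apply: Db; rewrite mem_cat as_ ?orbT.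
have [q [uq sq]] := ultraFilterLemma PF.
exists q; split=> // a; apply: sq; exists [:: a] => // b /= Db.
by apply: Db; rewrite inE.
Qed.

(** * Limits of rows of a stable relation are scattered *)

Section Isolated.
Context (A : eqType) (B : Type) (R : A -> B -> bool).

(** Definability of limits in a stable relation: [beta] is the limit of the rows
    [b (sigma n)] on the points [a k], and it depends on finitely many of the
    values [R (a k) (b s)] only.  Otherwise there are points [a k], [a l] in
    increasingly good agreement on all the [b s] with [beta k] true and [beta l]
    false; along an ultrafilter their limits against each [b s] agree, hence
    so do the double limits in one order, whereas those in the other order are
    [true] and [false]. *)
Lemma stable_definable (b : seq bool -> B) (sigma : nat -> seq bool)
    (a : nat -> A) (beta : nat -> bool) :
  stable R -> (forall n k, (k < n)%N -> R (a k) (b (sigma n)) = beta k) ->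
  exists N, forall k l,
    (forall j, (j < N)%N ->
       R (a k) (b (odflt [::] (choice.unpickle j))) =
       R (a l) (b (odflt [::] (choice.unpickle j)))) -> beta k = beta l.
Proof.
move=> stR Rb; apply: contrapT => /forallNP nN.
have {}nN N : exists kl : nat * nat, (forall j, (j < N)%N ->
       R (a kl.1) (b (odflt [::] (choice.unpickle j))) =
       R (a kl.2) (b (odflt [::] (choice.unpickle j)))) /\
    beta kl.1 /\ ~~ beta kl.2.
  have /existsNP[k /existsNP[l /not_implyP[Nkl bkl]]] := nN N.
  case: (boolP (beta k)) => bk; last first.
    case: (boolP (beta l)) => bl.
      by exists (l, k); split=> // j /Nkl.
    by rewrite (negbTE bk) (negbTE bl) in bkl.
  exists (k, l); split=> //; split=> //.
  by apply/negP => bl; rewrite bk bl in bkl.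
have [kl klP] := choice nN.
(* One nonprincipal ultrafilter serves for all the sequences involved. *)
have [u [uu su]] := ultraFilterLemma eventually_filter.
pose p1 := (a \o fst \o kl) @ u; pose p2 := (a \o snd \o kl) @ u.
pose q := (b \o sigma) @ u.
have up1 : UltraFilter p1 by exact: ultra_fmap.
have up2 : UltraFilter p2 by exact: ultra_fmap.
have uq : UltraFilter q by exact: ultra_fmap.
have lim k : \forall c \near q, R (a k) c = beta k.
  by apply: su; exists k.+1 => // n /= kn; exact: Rb.
have h1 : \forall x \near p1, \forall c \near q, R x c.
  apply: (@filterE _ u) => n /=.
  by apply: filterS (lim (kl n).1) => c ->; have [_ []] := klP n.
have h2 : ~ \forall x \near p2, \forall c \near q, R x c.
  move=> h; have [n /=] := @filter_ex _ u _ _ h.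
  move=> /(filterI (lim (kl n).2)) /filter_ex[c [-> bc]].
  by have [_ [_]] := klP n; rewrite bc.
apply: h2; apply/(stR _ _ up2 uq); move/(stR _ _ up1 uq) : h1.
have hs s : (\forall m \near u, R (a (kl m).1) (b s)) ->
    \forall m \near u, R (a (kl m).2) (b s).
  move=> /(filterI (su _ (nbhs_infty_gt (choice.pickle s)))).
  apply: filterS => m [/= mn].
  by have [/(_ _ mn) + _] := klP m; rewrite choice.pickleK /= => ->.
by apply: (@filterS _ u) => n; exact: hs.
Qed.

(** Without isolated points, [P] contains a binary tree of finite conditions:
    [cond s] is the condition at the node [s], [alpha] picks a point of [A] where
    both values are compatible with it, and [b s] is a row satisfying it.  There
    are countably many Boolean combinations of the [b s], so a branch of the tree
    can be chosen to disagree with each of them at some node.  The rows along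
    that branch converge at its nodes, which contradicts [stable_definable]. *)
Lemma stable_isolated (P : set (A -> bool)) :
  stable R -> P !=set0 -> P `<=` row_closure R ->
  exists2 t, P t &
    exists s : seq A, forall t', P t' -> {in s, t' =1 t} -> t' = t.
Proof.
move=> stR [t0 Pt0] PR; apply: contrapT => noiso.
have [a0 _] : exists a : A, True.
  apply: contrapT => nA; apply: noiso; exists t0 => //; exists [::] => t' _ _.
  by apply/funext => a; case: nA; exists a.
pose sat (C : seq (A * bool)) (t : A -> bool) := {in C, forall c, t c.1 = c.2}.
have split C : exists a, (exists2 t, P t & sat C t) ->
    forall v, exists2 t, P t & sat ((a, v) :: C) t.
  have [[t Pt Ct]|nC] := pselect (exists2 t, P t & sat C t); last first.
    by exists a0.
  have : ~ exists s : seq A, forall t', P t' -> {in s, t' =1 t} -> t' = t.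
    by move=> it; apply: noiso; exists t.
  move=> /forallNP/(_ (map fst C)) /existsNP[t'].
  move=> /not_implyP[Pt' /not_implyP[tt' ne]].
  have [a ta] : exists a, t' a <> t a.
    by apply/existsNP => e; apply: ne; apply/funext.
  exists a => _ v; have [<-|vt] := eqVneq (t a) v.
    by exists t => // c; rewrite inE => /predU1P[-> //|/Ct].
  exists t' => // c; rewrite inE => /predU1P[->/=|cC].
    by move: ta vt; case: (t' a); case: (t a); case: v.
  by rewrite tt' ?Ct//; apply/mapP; exists c.
have [alpha alphaP] := choice split.
(* A node lists the choices made below it, the last one first. *)
pose cond := fix cond (s : seq bool) : seq (A * bool) :=
  if s is v :: s' then (alpha (cond s'), v) :: cond s' else [::].
have condP s : exists2 t, P t & sat (cond s) t.
  by elim: s => [|v s IH] /=; [exists t0|exact: alphaP].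
have bP s : exists b, forall c, c \in cond s -> R c.1 b = c.2.
  have [t Pt st] := condP s; have [b Rb] := PR _ Pt (map fst (cond s)).
  by exists b => c cs; rewrite Rb ?st//; apply/mapP; exists c.
have [b {}bP] := choice bP.
pose vec N x := mkseq (fun j => R x (b (odflt [::] (choice.unpickle j)))) N.
(* [n] codes a pair [(N, S)], which stands for the Boolean combination that
   tells whether the values of the first [N] rows at [x] form a vector in [S]. *)
pose guess n x := if @choice.unpickle (nat * seq (seq bool))%type n is Some c
  then vec c.1 x \in c.2 else false.
pose sigma := fix sigma n : seq bool :=
  if n is n'.+1
  then ~~ guess n' (alpha (cond (sigma n'))) :: sigma n' else [::].
pose a n := alpha (cond (sigma n)).
pose beta n := ~~ guess n (a n).
have Rb n k : (k < n)%N -> R (a k) (b (sigma n)) = beta k.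
  move=> kn; apply: (bP (sigma n) (a k, beta k)).
  elim: n kn => // n IH; rewrite ltnS leq_eqVlt inE => /predU1P[->|/IH->].
    by rewrite eqxx.
  by rewrite orbT.
have [N NP] := stable_definable stR Rb.
(* The Boolean combination that computes [beta] from the first [N] rows. *)
pose S := [seq tval v | v <- enum {: N.-tuple bool}
           & `[< exists2 k, vec N (a k) = tval v & beta k >]].
pose n := choice.pickle (N, S).
suff : beta n = guess n (a n) by rewrite /beta; case: (guess n _).
rewrite /guess choice.pickleK /=; apply/idP/idP.
  move=> bn; apply/mapP.
  have sz : size (vec N (a n)) == N by rewrite size_mkseq.
  exists (Tuple sz) => //; rewrite mem_filter mem_enum andbT.
  by apply/asboolP; exists n.
move=> /mapP[v]; rewrite mem_filter => /andP[/asboolP[k kv bk] _] nv.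
rewrite -(NP k n) // => j jN.
move: (congr1 (nth false ^~ j) (etrans kv (esym nv))).
by rewrite !nth_mkseq.
Qed.
End Isolated.

(** * Minimal sets *)

Lemma compact_cover_compact (T : topologicalType) (K : set T) :
  K !=set0 -> compact K -> cover_compact K.
Proof.
move=> [k _]; pose pT : ptopologicalType := HB.pack T (isPointed.Build T k).
by rewrite -[@cover_compact _]/(@cover_compact pT) -compact_cover.
Qed.

(** A minimal set is the complement in [K] of a maximal open invariant set that
    does not cover [K]; compactness makes unions of chains of such sets again
    such sets.  The last clause is the form in which minimality is used: the
    translates of an open set that meets [M] form an open invariant set, so they
    cover [M], and finitely many suffice. *)
Lemma exists_minimal_set (G : groupType) (Z : topologicalType)
    (s : G -> Z -> Z) (K : set Z) :
  (forall g, continuous (s g)) -> (forall z, s 1%g z = z) ->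
  (forall g h z, s (g * h)%g z = s g (s h z)) ->
  compact K -> K !=set0 -> (forall g z, K z -> K (s g z)) ->
  exists M, [/\ M `<=` K, M !=set0, forall g z, M z -> M (s g z) &
    forall B, open B -> M `&` B !=set0 ->
      exists L : seq G, forall z, M z -> exists2 g, g \in L & B (s g z)].
Proof.
move=> s_cont s1 sM cK [k0 Kk0] sK.
pose P O := [/\ open O, forall g z, O z -> O (s g z) & ~ K `<=` O].
have [|O [[oO sO KO] maxO]] := @Zorn_bigcup _ P.
  move=> F FP totF; split.
  - by apply: bigcup_open => O /FP[].
  - by move=> g z [O FO Oz]; exists O => //; have [_ + _] := FP _ FO; apply.
  move=> KF.
  have /(_ _ F id) := compact_cover_compact (ex_intro _ _ Kk0) cK; case=> //.
    by move=> O /FP[].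
  move=> D DF KD.
  have [O FO DO] : exists2 O, O = set0 \/ F O
      & forall O', O' \in (D : seq _) -> O' `<=` O.
    have : forall O, O \in (D : seq _) -> F O by move=> O /DF /set_mem.
    elim: {DF KD} (D : seq _) => [_|O l IH lF]; first by exists set0; [left|].
    have [|O1 FO1 lO1] := IH.
      by move=> O' O'l; apply: lF; rewrite inE O'l orbT.
    have FO : F O by apply: lF; rewrite inE eqxx.
    have [O1O|OO1] : O1 `<=` O \/ O `<=` O1.
      case: FO1 => [O10|FO1]; last exact: totF.
      by left; rewrite O10; exact: sub0set.
    - exists O; first by right.
      move=> O'; rewrite inE => /predU1P[->//|/lO1 O'1].
      exact: subset_trans O1O.
    - by exists O1 => // O'; rewrite inE => /predU1P[->|/lO1].
  have KO : K `<=` O by move=> k /KD[O' /DO]; apply.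
  by case: FO KO => [-> /(_ _ Kk0)//|/FP[]].
have MO g z : (K `\` O) z -> (K `\` O) (s g z).
  move=> [Kz Oz]; split; first exact: sK.
  by move=> /(sO g^-1%g); rewrite -sM mulVg s1.
exists (K `\` O); split; [by move=> z []| |exact: MO|].
  by apply/set0P/eqP; rewrite setD_eq0.
move=> B oB [m [[Km Om] Bm]].
pose f (i : option G) := if i is Some g then s g @^-1` B else O.
have of_ i : open (f i).
  by case: i => [g|] //=; apply: open_comp => // z _; exact: s_cont.
(* By maximality of [O], adding the translates of [B] to it covers [K]. *)
have KV : K `<=` \bigcup_i f i.
  apply: contrapT => KV; apply: (maxO (\bigcup_i f i)).
    split; first by move=> z Oz; exists None.
    move=> VO; apply: Om; apply: VO; exists (Some 1%g) => //=.
    by rewrite s1.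
  split=> //; first by apply: bigcup_open.
  move=> g z [[h|] _ /= hz]; last by exists None => //; exact: sO.
  by exists (Some (h * g^-1)%g) => //=; rewrite -sM mulgVK.
have /(_ _ setT f) := compact_cover_compact (ex_intro _ _ Kk0) cK.
case=> // D _ KD.
exists (pmap id D) => z [Kz Oz]; have [[g|] /= gD gz] := KD _ Kz => //.
by exists g => //; rewrite mem_pmap map_id.
Qed.

Lemma continuous_into_prod (T : topologicalType) (I : Type)
    (K : I -> topologicalType) (f : T -> prod_topology K) :
  (forall i, continuous (fun x => f x i)) -> continuous f.
Proof.
move=> fc x; apply/cvg_sup => i; move: x.
by apply: (@continuous_comp_initial _ _ _ (@proj I K i)); exact: fc.
Qed.

Lemma open_agree (I : eqType) (s : seq I) (t : I -> bool) :
  open [set z : {ptws I -> bool} | {in s, z =1 t}].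
Proof.
elim: s => [|i s IH].
  by rewrite (_ : mkset _ = setT); [exact: openT|apply/seteqP; split].
rewrite (_ : mkset _ = [set z : {ptws I -> bool} | {in s, z =1 t}] `&`
    (@proj I _ i @^-1` [set t i])).
  apply: openI => //; apply: open_comp => [z _|]; first exact: proj_continuous.
  exact: discrete_open.
apply/seteqP; split=> z /= => [h|[h zi]].
  split=> [j js|]; last by apply: h; rewrite inE eqxx.
  by apply: h; rewrite inE js orbT.
by move=> j; rewrite inE => /predU1P[->//|/h].
Qed.

(** * Functions on a group with finitely many translates *)

Definition translates (G : groupType) (t : G -> bool) : set (G -> bool) :=
  range (fun k g => t (g * k)%g).

Section FiniteOrbits.
Context (G : groupType).

Lemma row_closure_limit (r t u : G -> bool) :
  row_closure (fun g h => r (g * h)%g) t ->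
  (forall s : seq G, exists k, {in s, forall g, u g = t (g * k)%g}) ->
  row_closure (fun g h => r (g * h)%g) u.
Proof.
move=> rt tu s; have [k uk] := tu s.
have [h rh] := rt [seq g * k | g <- s]%g.
exists (k * h)%g => g gs; rewrite uk// -rh ?mulgA//.
by apply/mapP; exists g.
Qed.

(** Coordinates indexed by [J] are treated simultaneously, in a minimal subset [M]
    of the orbit closure of [y] in [2^(J * G)].  For each [j], the set of [j]-th
    coordinates of points of [M] has an isolated point [t]; by minimality finitely
    many elements [h] of [G] are such that every point of [M] is moved by one of
    them to a point with [j]-th coordinate [t].  So that set of coordinates is
    finite, and it contains the orbit of each of its members. *)
Lemma exists_finite_translates (J : eqType) (r y : J -> G -> bool) :
  (forall j, stable (fun g h => r j (g * h)%g)) ->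
  (forall j, row_closure (fun g h => r j (g * h)%g) (y j)) ->
  exists z : J -> G -> bool,
    (forall s : seq (J * G), exists k,
       {in s, forall c, z c.1 c.2 = y c.1 (c.2 * k)%g}) /\
    forall j, finite_set (translates (z j)).
Proof.
move=> rst ry.
pose Z := {ptws J * G -> bool}.
pose sft (k : G) (z : Z) : Z := fun c => z (c.1, c.2 * k)%g.
have sftc k : continuous (sft k).
  apply: continuous_into_prod => c.
  exact: (@proj_continuous (J * G)%type (fun=> bool) (c.1, c.2 * k)%g).
have sft1 z : sft 1%g z = z by apply/funext => -[j g]; rewrite /sft mulg1.
have sftM g h z : sft (g * h)%g z = sft g (sft h z).
  by apply/funext => c; rewrite /sft /= mulgA.
pose orb (z : Z) := forall s : seq (J * G), exists k,
       {in s, forall c, z c = y c.1 (c.2 * k)%g}.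
have corb : compact (orb : set Z).
  apply: (@subclosed_compact _ _ [set: Z]) => //.
    rewrite -openC openE => z /existsNP[s nz].
    apply: filterS (open_nbhs_nbhs (conj (open_agree s z) _)) => //.
    move=> z' /= zz' /(_ s)[k zk].
    by apply: nz; exists k => c cs; rewrite -zk ?zz'.
  have := @tychonoff _ (fun _ : (J * G)%type => _) _ (fun=> bool_compact).
  by congr (compact _); apply/seteqP; split.
have [||M [Morb [m0 Mm0] Msft Mmin]] :=
  exists_minimal_set sftc sft1 sftM corb.
- by exists (fun c => y c.1 c.2) => s; exists 1%g => c _; rewrite mulg1.
- move=> g z oz s; have [k zk] := oz [seq (c.1, c.2 * g)%g | c <- s].
  exists (g * k)%g => c cs; rewrite /sft zk ?mulgA//.
  by apply/mapP; exists c.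
exists (fun j g => m0 (j, g)); split=> [s|j].
  by have [k mk] := Morb _ Mm0 s; exists k => -[j g] /mk.
pose P : set (G -> bool) := [set (fun g => z (j, g)) | z in M].
have Pm0 : P (fun g => m0 (j, g)) by exists m0.
have PR : P `<=` row_closure (fun g h => r j (g * h)%g).
  move=> _ [z Mz <-]; apply: row_closure_limit (ry j) _ => s.
  have [k zk] := Morb _ Mz [seq (j, g) | g <- s].
  by exists k => g gs; rewrite zk//; apply/mapP; exists g.
have [_ [t Mt <-] [s st]] :=
  stable_isolated (rst j) (ex_intro _ _ Pm0) PR.
have [|L LM] := Mmin _ (open_agree [seq (j, g) | g <- s] t).
  by exists t.
apply: (@sub_finite_set _ _ [set (fun g => t (j, g * h^-1)%g) | h in [set` L]]).
  move=> _ [k _ <-]; have [h hL Bh] := LM _ (Msft k _ Mm0).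
  have e : (fun g => sft h (sft k m0) (j, g)) = (fun g => t (j, g)).
    apply: st; first by exists (sft h (sft k m0)) => //; exact/Msft/Msft.
    by move=> g gs; apply: Bh; apply/mapP; exists g.
  exists h => //; apply/funext => g.
  by move/(congr1 (@^~ (g * h^-1)%g)): e => <-; rewrite /sft /= mulgVK.
by apply: finite_image; exact: finite_seq.
Qed.

Lemma ultra_attained (T : Type) (p : set_system T) (F : set (T -> bool)) :
  UltraFilter p -> finite_set F ->
  exists x, forall f, F f -> f x <-> \forall y \near p, f y.
Proof.
move=> up /finite_seqP[s ->].
suff : \forall x \near p, forall f, f \in s -> f x <-> \forall y \near p, f y.
  by move=> /filter_ex[x xs]; exists x.
elim: s => [|f s IH]; first by apply: filterE.
have fx : \forall x \near p, f x <-> \forall y \near p, f y.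
  have [pf|npf] := pselect (\forall y \near p, f y).
    by have := pf; apply: filterS => x fx; split.
  by have := (ultra_nearN f up).2 npf; apply: filterS => x /negP nfx; split.
apply: filterS (filterI fx IH) => x [xf xs] f'.
by rewrite inE => /predU1P[->//|f's]; exact: xs.
Qed.

Lemma stable_inv (r : G -> bool) :
  stable (fun g h => r (g * h)%g) -> stable (fun g h => r (g * h)^-1%g).
Proof.
move=> str.
have -> : (fun g h : G => r (g * h)^-1%g) = (fun g h => r (h^-1 * g^-1)%g).
  by apply/funext => g; apply/funext => h; rewrite invgM.
move=> p q up uq; apply: iff_sym.
exact: (str _ _ (ultra_fmap (fun g => g^-1)%g uq)
  (ultra_fmap (fun g => g^-1)%g up)).
Qed.

(** Inversion exchanges left and right translations, so this is
    [exists_finite_translates] for [r(g^-1)]; the translates of [w(g^-1)] are,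
    up to inversion, the left translates of [w]. *)
Lemma exists_finite_left_translates (r : G -> bool) :
  stable (fun g h => r (g * h)%g) ->
  exists w : G -> bool,
    row_closure (fun h g => r (g * h)%g) w /\
    finite_set (translates (fun g => w g^-1%g)).
Proof.
move=> rst; have str := stable_inv rst.
have [_|z [zr zf]] := @exists_finite_translates unit
  (fun _ g => r g^-1%g) (fun _ g => r g^-1%g) (fun=> str).
  by move=> s; exists 1%g => g _; rewrite mulg1.
exists (fun h => z tt h^-1%g); split.
  move=> s; have [k zk] := zr [seq (tt, h^-1)%g | h <- s].
  exists k^-1%g => h hs.
  by rewrite (zk (tt, h^-1%g)) /= ?invgM ?invgK//; apply/mapP; exists h.
have -> : (fun g => z tt g^-1^-1)%g = z tt by apply/funext => g; rewrite invgK.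
exact: zf.
Qed.

(** Let [w] be the limit of [r(g .)] along [p] and [t] the limit of [r(. h)]
    along [q].  By stability, [lim_p t(g k) = lim_q w(k h)] for all [k].  Since
    [t] has finitely many right translates, the left-hand side is [t(x k)] for a
    suitable [x]; since [w] has finitely many left translates, the right-hand
    side is [w(k c)] for a suitable [c].  Two limits [t] and [u] with finite
    orbits can use the same [x], and then differ by a right translation only. *)
Lemma finite_translates_finite (r : G -> bool) :
  stable (fun g h => r (g * h)%g) ->
  finite_set (row_closure (fun g h => r (g * h)%g) `&`
              [set t | finite_set (translates t)]).
Proof.
move=> str; have [w [rw wf]] := exists_finite_left_translates str.
have [p [up pw]] := row_closureP rw.
have lim t q k : UltraFilter q ->
    (forall g, \forall h \near q, r (g * h)%g = t g) ->
    (\forall g \near p, t (g * k)%g) <-> (\forall h \near q, w (k * h)%g).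
  move=> uq qt.
  (* Stability for [p] and for the image of [q] under left translation by [k]. *)
  have H := str _ _ up (ultra_fmap (fun h => k * h)%g uq).
  split=> h.
    have : \forall h \near q, \forall g \near p, r (g * (k * h))%g.
      apply/H; apply: filterS h => g tgk.
      by apply: filterS (qt (g * k)%g) => h /=; rewrite mulgA => ->.
    apply: filterS => h' H'.
    by have [g [/= ->]] := @filter_ex _ p _ _ (filterI (pw (k * h')%g) H').
  have : \forall g \near p, \forall h \near q, r (g * (k * h))%g.
    apply/H; apply: filterS h => h wkh.
    by apply: filterS (pw (k * h)%g) => g /= ->.
  apply: filterS => g H'.
  have [h' [/= <-]] := @filter_ex _ q _ _ (filterI (qt (g * k)%g) H').
  by rewrite mulgA.
have point t x : row_closure (fun g h => r (g * h)%g) t ->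
    (forall k, t (x * k)%g <-> \forall g \near p, t (g * k)%g) ->
    exists c, forall k, t (x * k)%g = w (k * c)%g.
  move=> /row_closureP[q [uq qt]] tx.
  have [c cP] := ultra_attained (ultra_fmap (fun g => g^-1)%g uq) wf.
  have wc k : w (k * c^-1)%g <-> \forall h \near q, w (k * h)%g.
    have /cP : translates (fun g => w g^-1%g) (fun g => w (g * k^-1)^-1)%g.
      by exists k^-1%g.
    rewrite invgM invgK => ->.
    have E h : w (h^-1 * k^-1)^-1%g = w (k * h)%g by rewrite invgM !invgK.
    by split; apply: (@filterS _ q) => h /=; rewrite E.
  exists c^-1%g => k; apply/idP/idP.
    by move=> tk; apply/wc/(lim _ _ _ uq qt)/tx.
  by move=> wk; apply/tx/(lim _ _ _ uq qt)/wc.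
have [[t [rt tf]]|nt] := pselect (exists t,
    row_closure (fun g h => r (g * h)%g) t /\ finite_set (translates t));
    last first.
  apply: (@sub_finite_set _ _ set0); last exact: finite_set0.
  by move=> t [rt tf]; apply: nt; exists t.
have := tf; apply: sub_finite_set => u [ru uf].
have [x xP] : exists x, forall f, (translates t `|` translates u) f ->
    f x <-> \forall y \near p, f y.
  by apply: (ultra_attained up); rewrite finite_setU; split.
have [|c tc] := point t x rt; first by move=> k; apply: xP; left; exists k.
have [|d ud] := point u x ru; first by move=> k; apply: xP; right; exists k.
exists (d * c^-1)%g => //; apply/funext => g.
have := tc (x^-1 * g * d * c^-1)%g; rewrite mulgVK.
by rewrite -ud !mulgA mulgV !mul1g.
Qed.
End FiniteOrbits.

(** * Weak limits of clopen sets *)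

Import Order.TTheory GRing.Theory Num.Theory.
Import numFieldNormedType.Exports.

Lemma clopen_indicator_continuous (X T : topologicalType) (v : bool -> T)
    (U : set X) : clopen U -> continuous (fun x => v `[< U x >]).
Proof.
move=> [oU cU] x; apply: (near_cst_continuous (v `[< U x >])).
have [Ux|nUx] := pselect (U x).
  have := open_nbhs_nbhs (conj oU Ux); apply: filterS => y Uy.
  by rewrite !asboolT.
have oUC : open (~` U) by rewrite openC.
have := open_nbhs_nbhs (conj oUC nUx); apply: filterS => y Uy.
by rewrite !asboolF.
Qed.

Section WeakLimits.
Local Open Scope ring_scope.
Context (R : realType) (X : compactHausdorffType).

Definition point_eval (x : X) (f : contfun R X) : R^o := ev f x.

Lemma point_eval_is_linear x : linear (point_eval x).
Proof. by move=> k f g; exact: erefl. Qed.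

HB.instance Definition _ x :=
  GRing.isLinear.Build R (contfun R X) R^o _ (point_eval x)
    (@point_eval_is_linear x).

Lemma point_eval_continuous x : continuous (point_eval x).
Proof.
move=> f; apply/(@cvgrPdist_lt _ _ _ (nbhs f)) => e e0.
have near_f : \forall g \near nbhs f, `|f - g| < e.
  by apply: (cvgr_dist_lt id f) => //; exact: cvg_id.
apply: filterS near_f => g.
apply: le_lt_trans; rewrite -linearB; exact: le_sup_norm.
Qed.

Lemma weak_eval_continuous x :
  continuous (fun f : weak (contfun R X) => ev (f : contfun R X) x : R).
Proof.
pose phi : continuous_dual (contfun R X) :=
  exist _ (point_eval x : {linear contfun R X -> R^o})
    (@point_eval_continuous x).
have phic : continuous
    ((@proj _ (fun=> R^o) phi) \o (@dual_pairing R (contfun R X)) :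
     weak (contfun R X) -> R^o).
  move=> f; apply: (@continuous_comp (weak (contfun R X))
    {ptws continuous_dual (contfun R X) -> R^o} R^o
    (@dual_pairing R (contfun R X)) (@proj _ (fun=> R^o) phi)); last first.
    exact: (@proj_continuous (continuous_dual (contfun R X)) (fun=> R^o) phi).
  exact: (@initial_continuous _ _ (@dual_pairing R (contfun R X))).
exact: phic.
Qed.
End WeakLimits.

Section WAPFlows.
Context (G : topologicalGroupType) (X : compactHausdorffType) (a : flow G X).

(** Along an ultrafilter, the translates of the characteristic function of [U]
    converge weakly to a continuous function; the point evaluations are in the
    dual, so this function is the pointwise limit, and it has values 0 and 1. *)
Lemma WAP_limit_clopen (R : realType) (U : set X) (p : set_system G) :
  WAP a R -> clopen U -> UltraFilter p ->
  clopen [set x | \forall g \near p, U (a g x)].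
Proof.
move=> wap cU up.
pose f : contfun R X :=
    mkcts (@clopen_indicator_continuous X R (fun b => b%:R)%R U cU).
have [B fB [cB _]] := wap f.
pose F : set_system (weak (contfun R X)) := (fun g => translate a g^-1%g f) @ p.
have uF : UltraFilter F by exact: ultra_fmap.
have FB : F B.
  by apply: (@filterE _ p) => g; apply: fB; exists g^-1%g.
move: cB; rewrite compact_ultra => /(_ F uF FB)[phi [_ Fphi]].
have lim x :
    (fun g => (`[< U (a g x) >])%:R : R)%R @ p --> ev (phi : contfun R X) x.
  have -> : (fun g => (`[< U (a g x) >])%:R : R)%R =
      (fun g => ev (translate a g^-1%g f) x).
    by apply/funext => g; rewrite -[in LHS](invgK g).
  exact: (cvg_comp _ _ Fphi (@weak_eval_continuous R X x phi)).
have V1 x : (\forall g \near p, U (a g x)) -> ev (phi : contfun R X) x = 1%R.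
  move=> pU; apply: (cvg_unique _ (lim x)) => //.
  apply: cvg_near_cst; apply: filterS pU => g Ug; by rewrite asboolT.
have V0 x : ~ (\forall g \near p, U (a g x)) -> ev (phi : contfun R X) x = 0%R.
  move=> pU; apply: (cvg_unique _ (lim x)) => //.
  have [//|pUC] := in_ultra_setVsetC [set g | U (a g x)] up.
  apply: cvg_near_cst; apply: filterS pUC => g Ug; by rewrite asboolF.
have phic : continuous (ev (phi : contfun R X)) by exact: ev_continuous.
split.
  have -> : [set x | \forall g \near p, U (a g x)] =
      ev (phi : contfun R X) @^-1` (~` [set 0%R]).
    apply/seteqP; split=> x /=.
      by move=> /V1 ->; apply/eqP; exact: oner_neq0.
    by move=> phi0; apply: contrapT => /V0.
  by apply: open_comp => // ; apply: closed_openC; exact: closed_eq.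
have -> : [set x | \forall g \near p, U (a g x)] =
    ev (phi : contfun R X) @^-1` [set 1%R].
  apply/seteqP; split=> x /=; first exact: V1.
  move=> phi1; apply: contrapT => /V0; rewrite phi1.
  by apply/eqP; exact: oner_neq0.
apply: preimage_closed => //; exact: closed_eq.
Qed.

(** * Return functions of a weakly almost periodic ambit *)

Definition visits (U : set X) (x : X) (g : G) : bool := `[< U (a g x) >].

Lemma clopen_near (U : set X) (F : set_system X) x :
  clopen U -> ProperFilter F -> F --> x -> (\forall y \near F, U y) <-> U x.
Proof.
move=> [oU cU] PF Fx; split=> [FU|Ux]; last first.
  exact: (Fx _ (open_nbhs_nbhs (conj oU Ux))).
apply: contrapT => nUx.
have oUC : open (~` U) by rewrite openC.
have FUC := Fx _ (open_nbhs_nbhs (conj oUC nUx)).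
by have [y []] := @filter_ex _ F _ _ (filterI FU FUC).
Qed.

(** Let [y] be the limit of [h x0] along [q], and [V] the set of points [x] such
    that [g x] is in [U] for [p]-almost all [g].  Both double limits say that [y]
    is in [V]: the first one because each [g] acts continuously and [U] is clopen,
    the second one because [V] is clopen. *)
Lemma WAP_stable (R : realType) (x0 : X) (U : set X) :
  WAP a R -> clopen U -> stable (fun g h => visits U x0 (g * h)%g).
Proof.
move=> wap cU p q up uq.
pose Q : set_system X := (fun h => a h x0) @ q.
have uQ : UltraFilter Q by exact: ultra_fmap.
have := @compactT X; rewrite compact_ultra.
move=> /(_ Q uQ (@filterT _ Q _))[y [_ Qy]].
pose V := [set x | \forall g \near p, U (a g x)].
have cV : clopen V := WAP_limit_clopen wap cU up.
have qy (W : set X) : clopen W -> (\forall h \near q, W (a h x0)) <-> W y.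
  by move=> cW; exact: (@clopen_near W Q).
have cUg g : clopen (a g @^-1` U).
  by apply: preimage_clopen => // ; exact: act_continuousr.
have E g h : visits U x0 (g * h)%g <-> U (a g (a h x0)).
  by rewrite /visits actM; split=> /asboolP.
apply: (@iff_trans _ (V y)).
  split; apply: filterS => g.
    move=> H; apply/(qy _ (cUg g)); apply: filterS H => h; by move/E.
  by move/(qy _ (cUg g)); apply: filterS => h; move/E.
apply: (iff_trans (iff_sym (qy _ cV))).
by split; apply: filterS => h; apply: filterS => g /E.
Qed.

Lemma visits_row_closure (x0 x : X) (U : set X) :
  is_ambit a x0 -> clopen U ->
  row_closure (fun g h => visits U x0 (g * h)%g) (visits U x).
Proof.
move=> amb cU s.
have visc : continuous (visits U : X -> {ptws G -> bool}).
  apply: (@continuous_into_prod X G (fun=> bool)) => g.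
  apply: (@clopen_indicator_continuous X bool id (a g @^-1` U)).
  by apply: preimage_clopen => //; exact: act_continuousr.
have oW := open_comp (fun z _ => visc z) (open_agree s (visits U x)).
have [|z [zs [h _ hz]]] := amb _ _ oW; first by exists x.
by exists h => g /zs <-; rewrite -hz /visits actM.
Qed.
End WAPFlows.

(** * Ramsey degrees *)

Theorem proposition3p32 (R : realType) (G : topologicalGroupType)
    (X : compactHausdorffType) (a : flow G X) (x0 : X) :
  is_ambit a x0 -> clopen_basis X -> WAP a R -> sep_fin_EDRdeg a.
Proof.
move=> amb _ wap Sigma finS clS.
pose rcl U := row_closure (fun g h => visits a U x0 (g * h)%g).
pose D := \bigcup_(U in Sigma) (rcl U `&` [set t | finite_set (translates t)]).
have finD : finite_set D.
  apply: bigcup_finite => // U /clS cU; apply: finite_translates_finite.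
  exact: WAP_stable wap cU.
have /finite_fsetP[E DE] := finD.
exists (2 ^ #|{: E}|)%N; first by rewrite expn_gt0.
move=> n c _ [U [y [SU cE]]] _ A _ _.
have visE i g : c g i = visits a (U i) (y i) g^-1%g.
  apply/idP/idP => [/(cE g i) [x Ux <-]|/asboolP Uy].
    by apply/asboolP; rewrite -actM mulVg act1.
  apply/cE; exists (a g^-1%g (y i)) => //.
  by rewrite -actM mulgV act1.
have yR i : rcl (U i) (visits a (U i) (y i)).
  by apply: visits_row_closure => //; exact/clS.
have [|z [zy zf]] :=
  @exists_finite_translates G 'I_n (fun i => visits a (U i) x0) _ _ yR.
  by move=> i; apply: WAP_stable wap _; exact/clS.
have zE i : z i \in E.
  suff : D (z i) by rewrite DE.
  exists (U i); first exact: SU.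
  split; last exact: zf.
  apply: (row_closure_limit (yR i)) => s.
  have [k zk] := zy [seq (i, g) | g <- s].
  by exists k => g gs; apply: (zk (i, g)); apply/mapP; exists g.
(* The value [c (k^-1 x) i] is that of the [i]-th return function at [x^-1 k]. *)
have [k zk] := zy [seq (i, x^-1)%g | i <- enum 'I_n, x <- enum_fset A].
exists k^-1%g.
(* The color of a point is determined by the values at one element of the group
   of all the functions in [E], whatever [n] is. *)
pose paint (w : {ffun E -> bool}) : {ffun 'I_n -> bool} :=
  [ffun i => w [` zE i]%fset].
apply: (@leq_trans #|` [fset paint w | w in {: {ffun E -> bool}}]%fset|).
  apply: fsubset_leq_card; apply/fsubsetP => v /imfsetP[x /= xA ->].
  apply/imfsetP; exists [ffun t : E => val t x^-1%g] => //=.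
  apply/ffunP => i; rewrite !ffunE /= visE invgM invgK.
  rewrite -(zk (i, x^-1%g))//.
  by apply/allpairsP; exists (i, x); rewrite mem_enum.
rewrite (leq_trans (leq_imfset_card _ _ _))//.
by rewrite -cardE card_ffun card_bool.
Qed.
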